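(* Let $K$ be a field and let $a,b\ge 1$ be positive integers. Then there exist a number $N>0$ and a monomial ideal $I\subset S=K[x_1,\dots,x_N]$ such that $$(\mathrm{astab}(I),\mathrm{vstab}(I))=(a,b).$$
   Context: Let $S=K[x_1,\dots,x_N]$ be a polynomial ring over a field $K$ with the standard grading ($\deg x_i=1$), and let $I\subset S$ be a graded (homogeneous) ideal; a monomial ideal is an ideal generated by monomials, and is in particular graded. $\mathrm{Ass}(I)$ denotes the set of associated primes of $I$, i.e. the prime ideals $\mathfrak p$ of the form $\mathfrak p=I:f$ for some $f\in S$ (the associated primes of the module $S/I$). By a theorem of Brodmann the sequence $\{\mathrm{Ass}(I^k)\}_{k\ge 1}$ is eventually constant. The index of ass-stability $\mathrm{astab}(I)$ is the least integer $k_0\ge 1$ such that $\mathrm{Ass}(I^k)=\mathrm{Ass}(I^{k_0})$ for all $k\ge k_0$. For $\mathfrak p\in\mathrm{Ass}(I)$, $\mathrm{v}_{\mathfrak p}(I)$ is the least degree of a homogeneous polynomial $f\in S$ with $I:f=\mathfrak p$, and the $\mathrm{v}$-number of $I$ is $\mathrm{v}(I)=\min_{\mathfrak p\in\mathrm{Ass}(I)}\mathrm{v}_{\mathfrak p}(I)$. Let $\alpha(I)=\min\{d: I_d\neq 0\}$ be the initial degree of $I$. It is known that there is an integer $c$ (depending on $I$) such that $\mathrm{v}(I^k)=\alpha(I)k+c$ for all sufficiently large $k$. The $\mathrm{v}$-stability index $\mathrm{vstab}(I)$ is the least integer $k_0\ge 1$ such that $\mathrm{v}(I^k)=\alpha(I)k+c$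 for all $k\ge k_0$. *)

(* Defs.v *)
From HB Require Import structures.
From mathcomp Require Import all_boot all_order all_algebra.
From mathcomp Require Import classical_sets mpoly.

Set Implicit Arguments.
Unset Strict Implicit.
Unset Printing Implicit Defensive.

Import GRing.Theory.

Local Open Scope classical_set_scope.
Local Open Scope ring_scope.

(* Ideals are classical sets, not the boolean predicates of ring_quotient:
   membership in a generated ideal is not given by a boolean test, and
   idealr_closed there excludes the unit ideal. *)
Section Ideals.
Variable R : comNzRingType.
Implicit Types (I J p A : set R) (f g r : R).

Definition is_ideal I : Prop :=
  [/\ I 0, forall f g, I f -> I g -> I (f + g) & forall r f, I f -> I (r * f)].

Definition ideal_span A : set R := smallest is_ideal A.

Definition ideal_mul I J : set R :=
  ideal_span [set h | exists f g, [/\ I f, J g & h = f * g]].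

Fixpoint ideal_exp I (k : nat) : set R :=
  if k is k'.+1 then ideal_mul I (ideal_exp I k') else setT.

Definition colon I f : set R := [set g | I (g * f)].

Definition is_prime_ideal p : Prop :=
  [/\ is_ideal p, ~ p 1 & forall f g, p (f * g) -> p f \/ p g].

Definition Ass I : set (set R) :=
  [set p | is_prime_ideal p /\ exists f, colon I f = p].

End Ideals.

Definition is_least (A : set nat) (n : nat) : Prop :=
  A n /\ forall m, A m -> (n <= m)%N.

(* The numerical invariants below are relations rather than functions, so that
   no value is assigned when the corresponding minimum does not exist. *)

Definition is_astab (R : comNzRingType) (I : set R) (a : nat) : Prop :=
  is_least [set k0 | (1 <= k0)%N /\
    forall k, (k0 <= k)%N -> Ass (ideal_exp I k) = Ass (ideal_exp I k0)] a.

Section Polynomials.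
Variables (N : nat) (K : fieldType).
Local Notation S := {mpoly K[N]}.
Implicit Types (I p : set S).

Definition is_monomial_ideal I : Prop :=
  exists M : set 'X_{1..N}, I = ideal_span [set 'X_[m] | m in M].

(* The zero polynomial is d.-homog for every d, but I : 0 is the unit ideal,
   so it never contributes when p is prime. *)
Definition is_local_vnumber I p (d : nat) : Prop :=
  is_least [set e | exists2 f : S, f \is e.-homog & colon I f = p] d.

Definition is_vnumber I (d : nat) : Prop :=
  is_least [set e | exists2 p, Ass I p & is_local_vnumber I p e] d.

Definition is_initial_degree I (d : nat) : Prop :=
  is_least [set e | exists f : S, [/\ I f, f != 0 & f \is e.-homog]] d.

(* The constant c may be negative; it is determined by I, as any two
   candidates must agree for large k. *)
Definition is_vstab I (b : nat) : Prop :=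
  exists (alpha : nat) (c : int), is_initial_degree I alpha /\
    is_least [set k0 | (1 <= k0)%N /\ forall k, (k0 <= k)%N ->
      exists2 v : nat, is_vnumber (ideal_exp I k) v
                     & v%:Z = alpha%:Z * k%:Z + c] b.

End Polynomials.

(* Main.v *)
(* Take N = 3 and I = I_0 + z I_1, where, with E = a + 1 and M large,
     I_0 = (x^2, y^2) (x^(2b+1), y^(2b+1)) (x^M, y^M) (x^(EM), y^(EM)),
     I_1 = (x^2, y^2) (x^(2b+1), y^(2b+1)) (x^M, y^M)^(E+1)
   are (x, y)-primary and generated in the same degree d = alpha(I).
   Every associated prime of I^k contains x and y, so it is (x, y) or (x, y, z);
   the former always occurs, and the latter is absent as soon as I_0^k = I_1^k,
   since then I^k is extended from K[x, y].  As [0, k] + E [0, k] is the whole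
   interval [0, k (E + 1)] iff k >= E - 1 = a, this happens exactly for k >= a.
   If I^k : f is prime then x f and y f lie in I^k, so v(I^k) >= d k - 1, with
   equality iff I_0^k contains two generators x^(i+1) y^j and x^i y^(j+1).  Since
   M is large, this means 2 i + (2b+1) j = 1 for some |i|, |j| <= k, that is,
   k >= b. *)
Require Import Defs.
From mathcomp Require Import all_boot all_order all_algebra.
From mathcomp Require Import classical_sets mpoly.
From mathcomp Require Import zify.

Set Implicit Arguments.
Unset Strict Implicit.
Unset Printing Implicit Defensive.

Import GRing.Theory.
Local Open Scope classical_set_scope.
Local Open Scope ring_scope.

(** * Ideal spans and prime ideals *)

Section PrimeIdeals.
Variables (R : comNzRingType).
Implicit Types (I p A : set R).

Lemma ideal_span_eq A I : is_ideal I -> A `<=` I ->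
  (forall J, is_ideal J -> A `<=` J -> I `<=` J) -> ideal_span A = I.
Proof.
move=> idI AI minI; apply/seteqP; split; first exact: smallest_sub.
by move=> f If J [idJ AJ]; apply: minI If.
Qed.

Lemma prime_ideal_exp p x k : is_prime_ideal p -> p (x ^+ k) -> p x.
Proof.
move=> [_ p1 prp]; elim: k => [|k IHk]; first by rewrite expr0.
by rewrite exprS => /prp [].
Qed.

Lemma sub_colon I f : is_ideal I -> I `<=` colon I f.
Proof. by move=> [_ _ IM] g Ig; rewrite /colon /= mulrC; apply: IM. Qed.

End PrimeIdeals.

(** * Monomial ideals as up-closed sets of exponents, and their associated primes *)

Section MonomialIdeals.
Variables (n : nat) (K : fieldType).
Local Notation S := {mpoly K[n]}.
Implicit Types (U V : set 'X_{1..n}) (f g : S) (T : pred 'I_n).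

(** For up-closed [U] these are the monomial ideals, with membership decided monomial by
    monomial. *)
Definition mideal U : set S := [set f | forall m, m \in msupp f -> U m].

Definition up_closed U : Prop := forall m h, U m -> U (m + h)%MM.

Definition mnm_mul U V : set 'X_{1..n} :=
  [set m | exists u v, [/\ U u, V v & m = (u + v)%MM]].

Definition mnm_up U : set 'X_{1..n} := mnm_mul U setT.

(** The prime ideal generated by the variables with index in [T]. *)
Definition var_ideal T : set S := mideal [set m | [exists i, T i && (m i != 0%N)]].

Lemma mnm_up_closed U : up_closed (mnm_up U).
Proof.
move=> m h [u [v [Uu _ ->]]]; exists u, (v + h)%MM; split=> //.
by rewrite addmA.
Qed.

Lemma mnm_mul_closed U V : up_closed U -> up_closed (mnm_mul U V).
Proof.
move=> upU m h [u [v [Uu Vv ->]]]; exists (u + h)%MM, v; split=> //; first exact: upU.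
by rewrite -!addmA [(v + h)%MM]addmC.
Qed.

Lemma mideal_ideal U : up_closed U -> is_ideal (mideal U).
Proof.
move=> upU; split.
- by move=> m; rewrite msupp0.
- move=> f g If Ig m /msuppD_le; rewrite mem_cat => /orP[]; [exact: If|exact: Ig].
move=> r f If m /msuppM_le /allpairsP [[m1 m2] /= [_ m2f ->]].
by rewrite addmC; apply/upU/If.
Qed.

Lemma midealX U m : mideal U 'X_[m] <-> U m.
Proof.
split=> [|Um k]; first by apply; rewrite msuppX inE.
by rewrite msuppX inE => /eqP ->.
Qed.

Lemma mideal_sum (I : set S) U f : is_ideal I ->
  (forall m, U m -> I 'X_[m]) -> mideal U f -> I f.
Proof.
move=> [I0 ID IM] UI Uf; rewrite [f]mpolyE big_seq; apply: (big_ind I) => // m mf.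
by rewrite -mul_mpolyC; apply/IM/UI/Uf.
Qed.

Lemma ideal_span_monomials U : ideal_span [set 'X_[m] | m in U] = mideal (mnm_up U).
Proof.
apply: ideal_span_eq; first exact/mideal_ideal/mnm_up_closed.
  move=> _ [m Um <-]; apply/midealX; exists m, 0%MM; split=> //.
  by rewrite addm0.
move=> J idJ UJ f; apply: mideal_sum => // _ [u [v [Uu _ ->]]].
by case: idJ => _ _ JM; rewrite addmC mpolyXD; apply/JM/UJ; exists u.
Qed.

Lemma ideal_mul_mideal U V : up_closed U ->
  ideal_mul (mideal U) (mideal V) = mideal (mnm_mul U V).
Proof.
move=> upU; apply: ideal_span_eq; first exact/mideal_ideal/mnm_mul_closed.
  move=> _ [f [g [If Ig ->]]] m /msuppM_le /allpairsP [[m1 m2] /= [m1f m2g ->]].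
  by exists m1, m2; split; [exact: If|exact: Ig|].
move=> J idJ sJ f; apply: mideal_sum => // _ [u [v [Uu Vv ->]]].
by rewrite mpolyXD; apply: sJ; exists 'X_[u], 'X_[v]; split=> //; apply/midealX.
Qed.

Fixpoint mnm_pow U k : set 'X_{1..n} :=
  if k is k'.+1 then mnm_mul U (mnm_pow U k') else setT.

Lemma mnm_pow_closed U k : up_closed U -> up_closed (mnm_pow U k).
Proof. by case: k => [|k] upU; [move=> m h|apply: mnm_mul_closed]. Qed.

Lemma ideal_exp_mideal U k : up_closed U ->
  ideal_exp (mideal U) k = mideal (mnm_pow U k).
Proof.
move=> upU; elim: k => [|k IHk] /=; first by apply/seteqP; split.
by rewrite IHk ideal_mul_mideal.
Qed.

Lemma colon_midealX U m : colon (mideal U) 'X_[m] = mideal [set w | U (m + w)%MM].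
Proof.
apply/seteqP; split=> g /= gU w.
  by move=> wg; apply: gU; rewrite mcoeff_msupp mcoeffMX -mcoeff_msupp.
by rewrite (perm_mem (msuppMX _ _)) => /mapP [v vg ->]; apply: gU.
Qed.

(* Strip leading terms off f: the leading monomial of g * f is the product of
   the leading monomials. *)
Lemma mideal_cancel U f g : up_closed U -> g != 0 ->
    (forall w m, w \in msupp g -> U (w + m)%MM -> U m) ->
  mideal U (g * f) -> mideal U f.
Proof.
move=> upU g0 cancU; have [U0 UD UM] := mideal_ideal upU.
have [k] := ubnP (size (msupp f)); elim: k f => // k IHk f ltfk Ugf.
have [->|f0] := eqVneq f 0; first exact: U0.
have Uf : U (mlead f).
  apply: (cancU (mlead g)); first exact: mlead_supp.
  by apply: Ugf; rewrite -mleadM // mlead_supp // mulf_neq0.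
rewrite -[f](subrK (f@_(mlead f) *: 'X_[mlead f])).
have UX : mideal U (f@_(mlead f) *: 'X_[mlead f]).
  by rewrite -mul_mpolyC; apply/UM/midealX.
apply: (UD) => //; apply: IHk.
  have := msupp_rem f (mlead f) => /perm_size ->; rewrite size_rem ?mlead_supp //.
  by case: (msupp f) (mlead_supp f0) ltfk.
by rewrite mulrBr -mulrN; apply: (UD) => //; rewrite -mulN1r mulrCA; do 2!apply: (UM).
Qed.

Lemma var_ideal_closed T : up_closed [set m | [exists i, T i && (m i != 0%N)]].
Proof.
move=> m h /= /existsP [i /andP [Ti mi]]; apply/existsP; exists i.
by rewrite Ti mnmDE; lia.
Qed.

(** Terms of [f] in (T) are subtracted one at a time. A nonzero remainder involves no variable of
    [T], so [mideal_cancel] removes it from the product. *)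
Lemma var_ideal_prime T : is_prime_ideal (var_ideal T).
Proof.
have upT := @var_ideal_closed T; have idT := mideal_ideal upT.
split=> //.
  move=> /(_ 0%MM); rewrite msupp1 inE eqxx => /(_ isT) /existsP [i].
  by rewrite mnm0E andbF.
have [T0 TD TM] := idT.
move=> f g; have [k] := ubnP (size (msupp f)); elim: k f => // k IHk f ltfk Tfg.
have [/hasP /= [m mf Tm]|noT] :=
  boolP (has (fun m : 'X_{1..n} => [exists i, T i && (m i != 0%N)]) (msupp f)).
  have UX : var_ideal T (f@_m *: 'X_[m]).
    by rewrite -mul_mpolyC; apply/TM/midealX.
  have [|||] := IHk (f - f@_m *: 'X_[m]).
  - have := msupp_rem f m => /perm_size ->; rewrite size_rem //.
    by case: (msupp f) mf ltfk.
  - rewrite mulrBl; apply: (TD) => //.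
    by rewrite -mulNr mulrC -mulN1r mulrA; apply: (TM).
  - by move=> h; left; rewrite -[f](subrK (f@_m *: 'X_[m])); apply: (TD).
  by right.
have [->|f0] := eqVneq f 0; first by left.
right; apply: (@mideal_cancel _ g f) => // w m wf /= /existsP [i /andP [Ti]].
rewrite mnmDE => wmi; apply/existsP; exists i; rewrite Ti /=.
have /hasPn /(_ w wf) /existsPn /(_ i) := noT; rewrite Ti /= negbK => /eqP wi.
by rewrite wi in wmi.
Qed.

(** The colon by a monomial is a monomial ideal, so it suffices to test monomials: those divisible
    by a variable of [T], and those free of [T]. *)
Lemma colon_mideal_var U T m : up_closed U ->
    (forall i, T i -> U (m + U_(i))%MM) ->
    (forall w : 'X_{1..n}, (forall i, T i -> w i = 0%N) -> ~ U (m + w)%MM) ->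
  colon (mideal U) 'X_[m] = var_ideal T.
Proof.
move=> upU TU nU; rewrite colon_midealX; apply/seteqP; split=> g /= gU w wg.
  case: (boolP [exists i, T i && (w i != 0%N)]) => // /existsPn noT.
  case: (nU w _ (gU w wg)) => i Ti; apply/eqP.
  by have := noT i; rewrite Ti /= negbK.
have /existsP [i /andP [Ti wi]] := gU w wg.
rewrite /= -(@submK _ U_(i) w) ?lep1mP // [(w - _ + _)%MM]addmC.
by rewrite addmA; apply/upU/TU.
Qed.

Lemma Ass_var_ideal U T m : up_closed U ->
    (forall i, T i -> U (m + U_(i))%MM) ->
    (forall w : 'X_{1..n}, (forall i, T i -> w i = 0%N) -> ~ U (m + w)%MM) ->
  Ass (mideal U) (var_ideal T).
Proof.
move=> upU TU nU; split; first exact: var_ideal_prime.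
by exists 'X_[m]; apply: colon_mideal_var.
Qed.

Lemma var_idealXU T i : var_ideal T 'X_i <-> T i.
Proof.
split=> [/midealX /existsP [j /andP [Tj]]|Ti].
  by rewrite mnm1E; have [->|] := eqVneq i j.
by apply/midealX/existsP; exists i; rewrite Ti mnm1E eqxx.
Qed.

(* If p contained some f outside (T), then f minus its part in (T) would be a
   nonzero element of p; it does not involve the variables in T, hence is a
   nonzerodivisor modulo U. *)
Lemma Ass_mideal_var U T p : up_closed U ->
    (forall m w : 'X_{1..n}, (forall i, T i -> w i = 0%N) -> U (w + m)%MM -> U m) ->
    (forall i, T i -> p 'X_i) ->
  Ass (mideal U) p -> p = var_ideal T.
Proof.
move=> upU cancU Tp [[[p0 pD pM] p1 prp] [f colf]].
have sTp : var_ideal T `<=` p.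
  move=> g; apply: mideal_sum => // m /existsP [i /andP [Ti mi]].
  by rewrite -(@submK _ U_(i) m) ?lep1mP // mpolyXD; apply/pM/Tp.
apply/seteqP; split=> // g.
have [T0 TD TM] := mideal_ideal (@var_ideal_closed T).
have [k] := ubnP (size (msupp g)); elim: k g => // k IHk g ltgk pg.
have [/hasP /= [m mg Tm]|noT] :=
  boolP (has (fun m : 'X_{1..n} => [exists i, T i && (m i != 0%N)]) (msupp g)).
  have UX : var_ideal T (g@_m *: 'X_[m]).
    by rewrite -mul_mpolyC; apply/TM/midealX.
  rewrite -[g](subrK (g@_m *: 'X_[m])); apply: (TD) => //; apply: IHk.
    have := msupp_rem g m => /perm_size ->; rewrite size_rem //.
    by case: (msupp g) mg ltgk.
  by apply: (pD) => //; rewrite -mulN1r; apply/pM/sTp.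
have [->|g0] := eqVneq g 0; first exact: T0.
case: p1; rewrite -colf /colon /= mul1r.
apply: (@mideal_cancel U f g) => //; last by rewrite -colf in pg.
move=> w m wg; apply: cancU => i Ti; apply/eqP.
by have /hasPn /(_ w wg) /existsPn /(_ i) := noT; rewrite Ti /= negbK.
Qed.

End MonomialIdeals.

(** * Arithmetic of the x-exponents in I_0^k and I_1^k *)

Section Exponents.
Local Open Scope nat_scope.
Variables b E M : nat.

(* The x-exponents of the generators of
   ((x^2, y^2) (x^(2b+1), y^(2b+1)) (x^M, y^M) (x^(EM), y^(EM)))^k. *)
Definition sparse_exp (k n : nat) : Prop := exists i j s r,
  [/\ i <= k, j <= k, s <= k, r <= k & n = 2 * i + (2 * b + 1) * j + M * (s + E * r)].

(* The x-exponents of the generators of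
   ((x^2, y^2) (x^(2b+1), y^(2b+1)) (x^M, y^M)^(E+1))^k. *)
Definition dense_exp (k n : nat) : Prop := exists i j t,
  [/\ i <= k, j <= k, t <= k * E.+1 & n = 2 * i + (2 * b + 1) * j + M * t].

Lemma sparse_dense k n : sparse_exp k n -> dense_exp k n.
Proof.
move=> [i [j [s [r [ik jk sk rk ->]]]]]; exists i, j, (s + E * r); split=> //.
by rewrite mulnS mulnC leq_add // leq_mul2r rk orbT.
Qed.

(** One needs [t = s + E * r] with [s, r <= k]: take [r = k] if [t >= k * E], and otherwise divide
    by [E], the remainder being at most [E - 1 <= k]. *)
Lemma dense_sparse k n : E <= k.+1 -> dense_exp k n -> sparse_exp k n.
Proof.
move=> Ek [i [j [t [ik jk tk ->]]]].
have [tkE|kEt] := leqP (k * E) t.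
  exists i, j, (t - k * E), k; split=> //; first by move: tk; rewrite mulnS; lia.
  by congr (_ + M * _); lia.
have E0 : 0 < E by case: E kEt; rewrite ?muln0.
exists i, j, (t %% E), (t %/ E); split=> //.
- by rewrite -ltnS (leq_trans _ Ek) // ltn_mod.
- by apply: ltnW; rewrite ltn_divLR.
- by congr (_ + M * _); rewrite [in LHS](divn_eq t E); lia.
Qed.

Lemma sparse_expD k1 k2 n1 n2 :
  sparse_exp k1 n1 -> sparse_exp k2 n2 -> sparse_exp (k1 + k2) (n1 + n2).
Proof.
move=> [i [j [s [r [? ? ? ? ->]]]]] [i' [j' [s' [r' [? ? ? ? ->]]]]].
exists (i + i'), (j + j'), (s + s'), (r + r'); split; try exact: leq_add; lia.
Qed.

Lemma dense_expD k1 k2 n1 n2 :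
  dense_exp k1 n1 -> dense_exp k2 n2 -> dense_exp (k1 + k2) (n1 + n2).
Proof.
move=> [i [j [s [? ? ? ->]]]] [i' [j' [s' [? ? ? ->]]]].
exists (i + i'), (j + j'), (s + s'); split; rewrite ?mulnDl; try exact: leq_add; lia.
Qed.

Lemma split_leqS k i : i <= k.+1 -> exists i1 i2, [/\ i1 <= 1, i2 <= k & i = i1 + i2].
Proof. by move=> ik; exists (minn i 1), (i - minn i 1); split; lia. Qed.

Lemma sparse_expS k n : sparse_exp k.+1 n ->
  exists n1 n2, [/\ sparse_exp 1 n1, sparse_exp k n2 & n = n1 + n2].
Proof.
move=> [i [j [s [r [/split_leqS [i1 [i2 [? ? ->]]] /split_leqS [j1 [j2 [? ? ->]]]]]]]].
move=> /split_leqS [s1 [s2 [? ? ->]]] /split_leqS [r1 [r2 [? ? ->]]] ->.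
exists (2 * i1 + (2 * b + 1) * j1 + M * (s1 + E * r1)).
exists (2 * i2 + (2 * b + 1) * j2 + M * (s2 + E * r2)).
split; [by exists i1, j1, s1, r1|by exists i2, j2, s2, r2|lia].
Qed.

Lemma dense_exp_bound k n : dense_exp k n -> n <= k * (2 * b + 3 + M * E.+1).
Proof.
move=> [i [j [t [ik jk tk ->]]]].
have := leq_mul (leqnn M) tk; have := leq_mul (leqnn (2 * b + 1)) jk; lia.
Qed.

Lemma sparse_exp_low k i j : i <= k -> j <= k -> sparse_exp k (2 * i + (2 * b + 1) * j).
Proof. by move=> ik jk; exists i, j, 0, 0; rewrite !muln0 addn0. Qed.

Lemma sparse_exp0 k : sparse_exp k 0.
Proof. by exists 0, 0, 0, 0; rewrite !muln0. Qed.

Lemma dense_exp_le1 k n : 0 < b -> 1 < M -> dense_exp k n -> n <= 1 -> n = 0.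
Proof.
move=> b0 M1 [i [j [t [_ _ _ ->]]]]; case: j => [|j]; last by rewrite mulnS; lia.
by case: t => [|t]; nia.
Qed.

(* Since M is large, two consecutive elements have the same multiple of M, so
   2 i + (2 b + 1) j = 1 for some integers i, j of absolute value at most k;
   as j is odd this forces |i| >= b. *)
Lemma dense_exp_no_adjacent k n : k < b -> k * (2 * b + 3) + 1 < M ->
  dense_exp k n -> dense_exp k n.+1 -> False.
Proof.
move=> kb kM [i [j [t [ik jk _ ->]]]] [i' [j' [t' [ik' jk' _ eq]]]].
have bj : (2 * b + 1) * j <= (2 * b + 1) * k by rewrite leq_mul2l jk orbT.
have bj' : (2 * b + 1) * j' <= (2 * b + 1) * k by rewrite leq_mul2l jk' orbT.
have tt' : t = t'.
  have [tt'|tt'|//] := ltngtP t t'.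
    have := leq_mul (leqnn M) tt'; rewrite mulnS; nia.
  have := leq_mul (leqnn M) tt'; rewrite mulnS; nia.
have [jj'|jj'|jj'] := ltngtP j j'.
- have := leq_mul (leqnn (2 * b + 1)) jj'; rewrite mulnS; subst t'; lia.
- have := leq_mul (leqnn (2 * b + 1)) jj'; rewrite mulnS; subst t'; nia.
- by subst t' j'; lia.
Qed.

(** A positive [r] contributes at least [M * E = M * k.+2]; hence [r = 0], and the rest is largest
    at [i = j = s = k]. *)
Lemma sparse_exp_gap k n : E = k.+2 -> sparse_exp k n -> n < M * k.+2 ->
  n <= k * (2 * b + 3) + M * k.
Proof.
move=> Ek [i [j [s [r [ik jk sk _ ->]]]]]; case: r => [|r] ltn; last first.
  by exfalso; move: ltn; rewrite Ek mulnDr [k.+2 * r.+1]mulnS mulnDr; lia.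
by have := leq_mul (leqnn M) sk; have := leq_mul (leqnn (2 * b + 1)) jk; lia.
Qed.

End Exponents.

(** * The ideal I_0 + z I_1 and the monomials of its powers *)

Section Construction.
Variables (K : fieldType) (b E M : nat).
Hypotheses (b_gt0 : (0 < b)%N) (M_gt1 : (1 < M)%N).
Local Notation S := {mpoly K[3]}.
Implicit Types (m w : 'X_{1..3}) (p : set S).

Let x : 'I_3 := @Ordinal 3 0 isT.
Let y : 'I_3 := @Ordinal 3 1 isT.
Let z : 'I_3 := @Ordinal 3 2 isT.

(** The common degree 2 + (2b + 1) + M + EM of the generators of I_0 and I_1. *)
Let d := (2 * b + 3 + M * E.+1)%N.
Let xy : pred 'I_3 := [pred i | i != z].

Let mon i j l : 'X_{1..3} := [multinom nth 0%N [:: i; j; l] c | c < 3].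

Let gens : set 'X_{1..3} := [set m | (m x + m y = d)%N /\
  (m z = 0%N /\ sparse_exp b E M 1 (m x) \/ m z = 1%N /\ dense_exp b E M 1 (m x))].

(* I_0 + z I_1: on generators of (x, y)-degree d, the x-exponent determines the
   y-exponent. *)
Definition example_ideal : set S := ideal_span [set 'X_[m] | m in gens].

Let I := example_ideal.
Let V := mnm_pow (mnm_up gens).

Let mdeg3 m : mdeg m = (m x + m y + m z)%N.
Proof.
by rewrite mdegE !big_ord_recl big_ord0 addn0 addnA; congr (m _ + m _ + m _)%N; apply: val_inj.
Qed.

Let ord3P (P : 'I_3 -> Prop) : P x -> P y -> P z -> forall i, P i.
Proof.
move=> Px Py Pz [[|[|[|i]]] lti] //.
- by rewrite (_ : Ordinal _ = x) //; apply: val_inj.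
- by rewrite (_ : Ordinal _ = y) //; apply: val_inj.
- by rewrite (_ : Ordinal _ = z) //; apply: val_inj.
Qed.

Let powE k : ideal_exp I k = mideal (V k).
Proof.
by rewrite /I /example_ideal ideal_span_monomials ideal_exp_mideal //; apply: mnm_up_closed.
Qed.

Let upV k : up_closed (V k).
Proof. exact/mnm_pow_closed/mnm_up_closed. Qed.

(** Here [n] is the x-exponent of a product of [k] generators dividing [m], whose y-exponent is
    [d * k - n]; it is dense because I_0 lies in I_1. *)
Let V_dense k m : V k m ->
  exists n, [/\ dense_exp b E M k n, (n <= m x)%N & (d * k <= n + m y)%N].
Proof.
elim: k m => [|k IHk] m /=; first by exists 0%N; split; rewrite ?muln0 //; apply/sparse_dense/sparse_exp0.
move=> [_ [v [[g [h [[gd gE] _ ->]]] /IHk [n [Dn nx ny]] ->]]].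
exists (g x + n)%N; rewrite !mnmDE; split; [|lia|rewrite mulnS; lia].
by rewrite -add1n; apply: dense_expD => //; case: gE => -[_ //]; apply: sparse_dense.
Qed.

(** As z does not divide [m], no factor comes from z I_1. *)
Let V_sparse k m : V k m -> m z = 0%N ->
  exists n, [/\ sparse_exp b E M k n, (n <= m x)%N & (d * k <= n + m y)%N].
Proof.
elim: k m => [|k IHk] m /=; first by exists 0%N; split; rewrite ?muln0 //; apply: sparse_exp0.
move=> [_ [v [[g [h [[gd gE] _ ->]]] /IHk Vv ->]]]; rewrite !mnmDE => mz.
have [|n [Dn nx ny]] := Vv; first by lia.
exists (g x + n)%N; split; [|lia|rewrite mulnS; lia].
by rewrite -add1n; apply: sparse_expD => //; case: gE => -[gz //]; lia.
Qed.

(** The generator x^n1 y^(d - n1) z^c is split off [m]; the bound [n2 <= d * k] leaves [m] enough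
    factors y for it. *)
Let V_cons k n1 n2 c m :
    c = 0%N /\ sparse_exp b E M 1 n1 \/ c = 1%N /\ dense_exp b E M 1 n1 ->
    (forall m', (n2 <= m' x)%N -> (d * k <= n2 + m' y)%N -> V k m') ->
    (n1 + n2 <= m x)%N -> (d * k.+1 <= n1 + n2 + m y)%N -> (c <= m z)%N ->
    (n2 <= d * k)%N ->
  V k.+1 m.
Proof.
move=> n1E Vn2 mx my mz n2d.
have n1d : (n1 <= d)%N.
  rewrite -[d]mul1n; apply: (@dense_exp_bound b E M 1).
  by case: n1E => -[_ //]; apply: sparse_dense.
have gm : (mon n1 (d - n1) c <= m)%MM.
  by apply/mnm_lepP; apply: ord3P; rewrite mnmE /=; lia.
exists (mon n1 (d - n1) c), (m - mon n1 (d - n1) c)%MM; split.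
- exists (mon n1 (d - n1) c), 0%MM; split=> //; last by rewrite addm0.
  by rewrite /gens /= !mnmE /=; split; [lia|].
- by apply: Vn2; rewrite mnmBE mnmE /=; lia.
by rewrite addmC submK.
Qed.

Let sparse_V k n m : sparse_exp b E M k n ->
  (n <= m x)%N -> (d * k <= n + m y)%N -> V k m.
Proof.
elim: k n m => // k IHk _ m /sparse_expS [n1 [n2 [S1 S2 ->]]] mx my.
apply: (@V_cons k n1 n2 0%N) => //; first by left.
  by move=> m'; apply: IHk.
by rewrite mulnC; apply/dense_exp_bound/sparse_dense.
Qed.

Let V_full k : V k (mon (d * k) 0 0) /\ V k (mon 0 (d * k) 0).
Proof.
split; [apply: (@sparse_V k (d * k))|apply: (@sparse_V k 0)]; rewrite ?mnmE //=.
- by exists k, k, k, k; split=> //; rewrite /d; lia.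
- by rewrite leq_addr.
- exact: sparse_exp0.
Qed.

(** * Associated primes of the powers *)

Let prime_xy k p f : is_prime_ideal p -> colon (ideal_exp I k) f = p ->
  p 'X_x /\ p 'X_y.
Proof.
move=> prp colp; have [Vx Vy] := V_full k.
have Vp : mideal (V k) `<=` p.
  by rewrite -colp powE; apply: sub_colon; apply: mideal_ideal.
split; apply: (@prime_ideal_exp _ p _ (d * k)) => //; apply: Vp;
  rewrite mpolyXn; apply/midealX.
- by rewrite (_ : _ *+ _ = mon (d * k) 0 0)%MM //; apply/mnmP; apply: ord3P;
    rewrite mulmnE mnm1E mnmE /=; lia.
- by rewrite (_ : _ *+ _ = mon 0 (d * k) 0)%MM //; apply/mnmP; apply: ord3P;
    rewrite mulmnE mnm1E mnmE /=; lia.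
Qed.

Let colon_xy k i j : V k (mon i.+1 j 0) -> V k (mon i j.+1 0) ->
    (forall l, ~ V k (mon i j l)) ->
  colon (ideal_exp I k) 'X_[mon i j 0] = var_ideal xy.
Proof.
move=> Vx Vy nV; rewrite powE; apply: colon_mideal_var => //.
  apply: ord3P => // _.
  - by rewrite (_ : _ + _ = mon i.+1 j 0)%MM //; apply/mnmP; apply: ord3P;
      rewrite mnmDE mnm1E !mnmE /=; lia.
  - by rewrite (_ : _ + _ = mon i j.+1 0)%MM //; apply/mnmP; apply: ord3P;
      rewrite mnmDE mnm1E !mnmE /=; lia.
move=> w w0; rewrite (_ : _ + _ = mon i j (w z))%MM //; apply/mnmP.
by apply: ord3P; rewrite mnmDE !mnmE /= ?(w0 x isT) ?(w0 y isT) ?addn0.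
Qed.

Let Ass_xy k : (0 < k)%N -> Ass (ideal_exp I k) (var_ideal xy).
Proof.
move=> k0; split; first exact: var_ideal_prime.
have dk : (0 < d * k)%N by rewrite /d; lia.
(* Multiplication by x or y reaches the exponents 2 and 0; the only dense exponent at most 1 is 0,
   and it would require y^(d k). *)
exists 'X_[mon 1 (d * k).-1 0]; apply: colon_xy.
- apply: (@sparse_V k 2); rewrite ?mnmE //=; last by lia.
  by exists 1%N, 0%N, 0%N, 0%N; split=> //; lia.
- apply: (@sparse_V k 0); rewrite ?mnmE //=; last by lia.
  exact: sparse_exp0.
move=> l /V_dense [n]; rewrite !mnmE /= => -[Dn n1].
by rewrite (dense_exp_le1 b_gt0 M_gt1 Dn n1); lia.
Qed.

(** For such [k] dense exponents are sparse, so powers of z cancel from the monomials of I^k and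
    only (x, y) is left. *)
Let Ass_stable k : (0 < k)%N -> (E <= k.+1)%N -> Ass (ideal_exp I k) = [set var_ideal xy].
Proof.
move=> k0 Ek; apply/seteqP; split=> [p Ap|p ->]; last exact: Ass_xy.
have [prp [f colf]] := Ap; have [px py] := prime_xy prp colf.
rewrite powE in Ap; apply: (@Ass_mideal_var _ _ (V k)) Ap => //; last exact: ord3P.
move=> m w w0 /V_dense [n [Dn nx ny]]; apply: (@sparse_V k n); first exact: dense_sparse.
- by move: nx; rewrite mnmDE w0.
- by move: ny; rewrite mnmDE w0.
Qed.

(* With E = k + 2, the x-exponents M (k + 1) + [0, k (2 b + 3)] occur in I_1^k but
   not in I_0^k; the witness sits in the corner of this gap, between the
   exponents n0 and M (k + 2) of I_0^k. *)
Let Ass_xyz k : (0 < k)%N -> E = k.+2 -> (k * (2 * b + 3) + 1 < M)%N ->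
  Ass (ideal_exp I k) (var_ideal predT).
Proof.
move=> k0 Ek kM; set n0 := (k * (2 * b + 3) + M * k)%N.
have n0d : (n0 < d * k)%N by rewrite /n0 /d Ek; nia.
have Mk : (n0.+1 <= M * k.+1)%N by rewrite /n0 mulnS; lia.
rewrite powE; apply: (@Ass_var_ideal _ _ (V k) predT
  (mon (M * k.+2).-1 (d * k - n0.+1) 0)) => //.
  apply: ord3P => _.
  - apply: (@sparse_V k (M * k.+2)); rewrite ?mnmDE ?mnm1E ?mnmE /=; try lia.
    by exists 0%N, 0%N, 0%N, 1%N; split=> //; rewrite Ek; lia.
  - apply: (@sparse_V k n0); rewrite ?mnmDE ?mnm1E ?mnmE /=; try lia.
    by exists k, k, k, 0%N; split=> //; rewrite /n0; lia.
  (* One generator of z I_1 with x-exponent [M * k.+1] is multiplied by y^(d (k - 1));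
     [n0.+1 <= M * k.+1] leaves enough factors y. *)
  have Vz : V k.-1.+1 (mon (M * k.+2).-1 (d * k - n0.+1) 0 + U_(z))%MM.
    apply: (@V_cons _ (M * k.+1) 0 1%N); rewrite ?prednK ?mnmDE ?mnm1E ?mnmE //=; try lia.
      by right; split=> //; exists 0%N, 0%N, k.+1; split=> //; lia.
    by move=> m'; apply: sparse_V; apply: sparse_exp0.
  by rewrite prednK in Vz.
move=> w w0; rewrite (_ : _ + w = mon (M * k.+2).-1 (d * k - n0.+1) 0)%MM; last first.
  by apply/mnmP; apply: ord3P; rewrite mnmDE w0 //; lia.
move=> /V_sparse; rewrite !mnmE /= => -[] // n [Sn nx ny].
by have := sparse_exp_gap Ek Sn; rewrite -/n0; lia.
Qed.

Lemma example_monomial : is_monomial_ideal I.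
Proof. by exists gens. Qed.

Lemma example_astab a : (0 < a)%N -> E = a.+1 -> (a.-1 * (2 * b + 3) + 1 < M)%N ->
  is_astab I a.
Proof.
move=> a0 Ea aM; have stab k : (a <= k)%N -> Ass (ideal_exp I k) = [set var_ideal xy].
  by move=> ak; apply: Ass_stable; lia.
split=> [|m [m0 stabm]]; first by split=> // k ak; rewrite !stab.
(* Since [E = (a - 1) + 2], stability from some [m < a] would carry (x, y, z) from I^(a-1) to
   I^a. *)
rewrite leqNgt; apply/negP => ma.
have : Ass (ideal_exp I a.-1) (var_ideal predT) by apply: Ass_xyz => //; lia.
rewrite stabm; last by lia.
rewrite -(stabm a) ?stab ?(ltnW ma) // => xyz.
have : var_ideal xy ('X_z : S) by rewrite -xyz; apply/var_idealXU.
by move/var_idealXU.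
Qed.

(** * The v-numbers of the powers *)

Let homog_V k (f : S) e : f \is e.-homog -> f != 0 -> mideal (V k) f -> (d * k <= e)%N.
Proof.
move=> /dhomogP he f0 Vf; have mf := mlead_supp f0.
rewrite -(he _ mf) /= mdeg3; have [n [_ nx ny]] := V_dense (Vf _ mf); lia.
Qed.

Let colon_nz k (f : S) p : is_prime_ideal p -> colon (ideal_exp I k) f = p -> f != 0.
Proof.
move=> [_ p1 _] colp; apply/eqP => f0; apply: p1.
by rewrite -colp f0 powE /colon /= mulr0 => m; rewrite msupp0.
Qed.

Let local_v_ge k (f : S) p e : is_prime_ideal p -> f \is e.-homog ->
  colon (ideal_exp I k) f = p -> (d * k <= e.+1)%N.
Proof.
move=> prp hf colp; have [px _] := prime_xy prp colp.
have f0 := colon_nz prp colp.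
apply: (@homog_V k ('X_x * f)).
- by rewrite -[e.+1]add1n; apply: dhomogM => //; rewrite dhomogX /= mdeg1.
- by rewrite mulf_neq0 //; rewrite -msupp_eq0 msuppX.
by rewrite -powE; rewrite -colp in px.
Qed.

Let v_stable k : (b <= k)%N -> is_vnumber (ideal_exp I k) (d * k).-1.
Proof.
move=> bk; have k0 : (0 < k)%N by lia.
have dk : (2 * b + 3 <= d * k)%N by rewrite /d; nia.
split=> [|e [p [prp _] [[f hf colp] _]]]; last by have := local_v_ge prp hf colp; lia.
exists (var_ideal xy); first exact: Ass_xy.
split=> [|e [f hf colp]]; last first.
  by have := local_v_ge (@var_ideal_prime _ _ xy) hf colp; lia.
(* The adjacent exponents [2 * b] and [2 * b + 1] come from [i = b <= k] and from [j = 1]; the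
   degree d k - 1 in x and y is too small for I^k, whatever the power of z. *)
exists 'X_[mon (2 * b) (d * k - (2 * b).+1) 0].
  by rewrite dhomogX /= mdeg3 !mnmE /=; apply/eqP; lia.
apply: colon_xy.
- apply: (@sparse_V k (2 * 0 + (2 * b + 1) * 1)); rewrite ?mnmE /=; try lia.
  exact: sparse_exp_low.
- apply: (@sparse_V k (2 * b + (2 * b + 1) * 0)); rewrite ?mnmE /=; try lia.
  exact: sparse_exp_low.
by move=> l /V_dense [n [_]]; rewrite !mnmE /=; lia.
Qed.

Let v_adjacent k : (0 < k)%N -> is_vnumber (ideal_exp I k) (d * k).-1 ->
  exists n, dense_exp b E M k n /\ dense_exp b E M k n.+1.
Proof.
move=> k0 [[p [prp _] [[f hf colp] _]] _].
have [px py] := prime_xy prp colp; have f0 := colon_nz prp colp.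
rewrite -colp powE /colon /= mulrC in px; rewrite -colp powE /colon /= mulrC in py.
have mf := mlead_supp f0; set m := mlead f in mf.
have dk : (0 < d * k)%N by rewrite /d; lia.
have /dhomogP /(_ _ mf) := hf; rewrite /= mdeg3 => degm.
have Vx : V k (m + U_(x))%MM.
  by apply: px; rewrite (perm_mem (msuppMX _ _)) addmC map_f.
have Vy : V k (m + U_(y))%MM.
  by apply: py; rewrite (perm_mem (msuppMX _ _)) addmC map_f.
(* As [m] has degree d k - 1, the bounds force [n2 = m x] and [n1 = m x + 1]. *)
have [n1 [D1]] := V_dense Vx; have [n2 [D2]] := V_dense Vy.
rewrite !mnmDE !mnm1E /= => n2x n2y n1x n1y.
exists n2; split=> //; rewrite (_ : n2.+1 = n1) //; lia.
Qed.

Lemma example_vstab : (b.-1 * (2 * b + 3) + 1 < M)%N -> is_vstab I b.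
Proof.
move=> bM; exists d, (-1)%R; split.
  split=> [|e [f [If f0 hf]]].
    exists 'X_[mon d 0 0]; split.
    - rewrite /I /example_ideal ideal_span_monomials; apply/midealX.
      have [] := V_full 1; rewrite muln1 => -[u [v [Uu _ ->]]] _.
      exact: mnm_up_closed.
    - by rewrite -msupp_eq0 msuppX.
    by rewrite dhomogX /= mdeg3 !mnmE /= !addn0.
  have := @homog_V 1 f e hf f0; rewrite muln1; apply.
  rewrite /I /example_ideal ideal_span_monomials in If.
  by move=> m /If Um; exists m, 0%MM; split=> //; rewrite addm0.
have dk k : (0 < k)%N -> (0 < d * k)%N by rewrite /d; lia.
split=> [|m [m0 stabm]].
  split=> // k bk; exists (d * k).-1; first exact: v_stable.
  by have := dk k; lia.
rewrite leqNgt; apply/negP => mb.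
have [v vm veq] := stabm m (leqnn m).
have {}veq : v = (d * m).-1 by have := dk m m0; lia.
rewrite veq in vm; have [n [D1 D2]] := v_adjacent m0 vm.
apply: (dense_exp_no_adjacent mb _ D1 D2).
by have : (m <= b.-1)%N; [lia|nia].
Qed.

End Construction.

Theorem theorem2p1 (K : fieldType) (a b : nat) (ha : (1 <= a)%N) (hb : (1 <= b)%N) :
  exists (N : nat) (I : set {mpoly K[N]}),
    [/\ (0 < N)%N, is_monomial_ideal I, is_astab I a & is_vstab I b].
Proof.
(* Large enough for both [(a - 1) * (2 * b + 3) + 1 < M] and [(b - 1) * (2 * b + 3) + 1 < M]. *)
pose M := ((a + b) * (2 * b + 3))%N; have M1 : (1 < M)%N by rewrite /M; nia.
exists 3, (@example_ideal K b a.+1 M); split=> //.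
- exact: example_monomial.
- by apply: example_astab => //; rewrite /M; nia.
- by apply: example_vstab => //; rewrite /M; nia.
Qed.
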